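(* Assume that all $S_i$, $i=1,2,\ldots,n$, are invertible. Let $$\mathcal{P}_n=\begin{bmatrix} A_1 & & & \\ C_1 & -S_2 & & \\ & \ddots & \ddots & \\ & & C_{n-1} & (-1)^{n-1}S_n\end{bmatrix},$$ the block lower bidiagonal matrix with $(i,i)$ block $(-1)^{i-1}S_i$ and $(i+1,i)$ block $C_i$. Then $\mathcal{P}_n=\mathcal{L}_n\mathcal{D}_n$, $\mathcal{P}_n^{-1}\mathcal{A}_n=\mathcal{U}_n$, and $\mathcal{P}_n^{-1}\mathcal{A}_n$ satisfies the polynomial equation $(\lambda-1)^n=0$, i.e. $(\mathcal{P}_n^{-1}\mathcal{A}_n-I)^n=0$. Furthermore, if $\mathcal{A}_n$ is symmetric and $A_i$ is symmetric positive definite for every $i=1,2,\ldots,n$, then all eigenvalues of $\mathcal{D}_n^{-1}\mathcal{A}_n$ are positive real, meaning that they all have positive real part.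
   Context: Let $n\ge 2$ and $m_1,\dots,m_n\ge 1$. For $i=1,\dots,n$, $A_i$ is a real $m_i\times m_i$ matrix, and for $i=1,\dots,n-1$, $B_i,C_i$ are real $m_{i+1}\times m_i$ matrices. The block tridiagonal matrix $\mathcal{A}_n$ has $(i,i)$ block $(-1)^{i-1}A_i$, $(i,i+1)$ block $B_i^T$, $(i+1,i)$ block $C_i$, and all other blocks zero: $$\mathcal{A}_n=\begin{bmatrix} A_1 & B_1^T & & \\ C_1 & -A_2 & \ddots & \\ & \ddots & \ddots & B_{n-1}^T\\ & & C_{n-1} & (-1)^{n-1}A_n\end{bmatrix}.$$ The nested Schur complements are $S_1=A_1$ and $S_{i+1}=A_{i+1}+C_iS_i^{-1}B_i^T$ for $i=1,\dots,n-1$ (each defined when the preceding one is invertible). $\mathcal{D}_n$ is the block diagonal matrix with $(i,i)$ block $(-1)^{i-1}S_i$. $\mathcal{L}_n$ is the block lower bidiagonal matrix with identity diagonal blocks and $(i+1,i)$ block $(-1)^{i-1}C_iS_i^{-1}$. $\mathcal{U}_n$ is the block upper bidiagonal matrix with identity diagonal blocks and $(i,i+1)$ block $(-1)^{i-1}S_i^{-1}B_i^T$. In the paper's terminology, the eigenvalues of a matrix are called ''positive real'' if the real parts of all of them are positive (they need not be real numbers). *)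

(* Defs.v *)
From mathcomp Require Import all_boot all_order all_algebra.
From mathcomp Require Import reals complex.

Set Implicit Arguments.
Unset Strict Implicit.
Unset Printing Implicit Defensive.

Import GRing.Theory Num.Theory.
Local Open Scope ring_scope.

(* Blocks are numbered from 0, so the sign (-1)^(i-1) of block number i in
   1-based numbering reads (-1) ^+ i.  The families of blocks are indexed by
   nat, because block i.+1 must be definable from block i; an n x n block matrix
   only uses A 0, ..., A n.-1 and B 0, ..., B n.-2 (likewise C). *)

(* The block in position (i, j) of the block tridiagonal matrix with diagonal
   blocks D i, blocks U i in position (i, i.+1) and L i in position (i.+1, i).
   In each branch the two dimensions agree, so conform_mx is a mere cast. *)
Definition tridiag_block (R : nzRingType) (m : nat -> nat)
    (D : forall i, 'M[R]_(m i)) (U : forall i, 'M[R]_(m i, m i.+1))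
    (L : forall i, 'M[R]_(m i.+1, m i)) (i j : nat) : 'M[R]_(m i, m j) :=
  if i == j then conform_mx 0 (D i)
  else if j == i.+1 then conform_mx 0 (U i)
  else if i == j.+1 then conform_mx 0 (L j)
  else 0.

Definition tridiag_mx (R : nzRingType) (m : nat -> nat) (n : nat)
    (D : forall i, 'M[R]_(m i)) (U : forall i, 'M[R]_(m i, m i.+1))
    (L : forall i, 'M[R]_(m i.+1, m i)) : 'M[R]_(\sum_(i < n) m i) :=
  \mxblock_(i < n, j < n) tridiag_block D U L i j.

(* The nested Schur complements S_(i.+1).  As invmx is total (invmx M = M when M
   is singular), schur A B C i is meaningful only if its predecessors are
   invertible. *)
Fixpoint schur (R : fieldType) (m : nat -> nat) (A : forall i, 'M[R]_(m i))
    (B C : forall i, 'M[R]_(m i.+1, m i)) (i : nat) : 'M[R]_(m i) :=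
  if i is k.+1 then A k.+1 + C k *m invmx (schur A B C k) *m (B k)^T
  else A 0%N.

Definition calA (R : fieldType) (m : nat -> nat) (n : nat)
    (A : forall i, 'M[R]_(m i)) (B C : forall i, 'M[R]_(m i.+1, m i)) :
    'M[R]_(\sum_(i < n) m i) :=
  tridiag_mx n (fun i => (-1) ^+ i *: A i) (fun i => (B i)^T) C.

Definition calD (R : fieldType) (m : nat -> nat) (n : nat)
    (A : forall i, 'M[R]_(m i)) (B C : forall i, 'M[R]_(m i.+1, m i)) :
    'M[R]_(\sum_(i < n) m i) :=
  tridiag_mx n (fun i => (-1) ^+ i *: schur A B C i) (fun=> 0) (fun=> 0).

Definition calL (R : fieldType) (m : nat -> nat) (n : nat)
    (A : forall i, 'M[R]_(m i)) (B C : forall i, 'M[R]_(m i.+1, m i)) :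
    'M[R]_(\sum_(i < n) m i) :=
  tridiag_mx n (fun=> 1%:M) (fun=> 0)
    (fun i => (-1) ^+ i *: (C i *m invmx (schur A B C i))).

Definition calU (R : fieldType) (m : nat -> nat) (n : nat)
    (A : forall i, 'M[R]_(m i)) (B C : forall i, 'M[R]_(m i.+1, m i)) :
    'M[R]_(\sum_(i < n) m i) :=
  tridiag_mx n (fun=> 1%:M)
    (fun i => (-1) ^+ i *: (invmx (schur A B C i) *m (B i)^T)) (fun=> 0).

Definition calP (R : fieldType) (m : nat -> nat) (n : nat)
    (A : forall i, 'M[R]_(m i)) (B C : forall i, 'M[R]_(m i.+1, m i)) :
    'M[R]_(\sum_(i < n) m i) :=
  tridiag_mx n (fun i => (-1) ^+ i *: schur A B C i) (fun=> 0) C.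

Definition sympd (R : realType) (k : nat) (M : 'M[R]_k) : Prop :=
  M^T = M /\ forall x : 'cV[R]_k, x != 0 -> 0 < (x^T *m M *m x) 0 0.

(* "Positive real" means positive real part: the eigenvalues need not be real. *)
Definition positive_real_eigenvalues (R : realType) (k : nat) (M : 'M[R]_k) :
    Prop :=
  forall a : R[i], eigenvalue (map_mx (real_complex R) M) a -> 0 < complex.Re a.

(* Main.v *)
(* The Schur recursion is block Gaussian elimination: it gives A_n = P_n U_n
   with P_n = L_n D_n, and U_n - I is strictly block upper triangular, hence
   nilpotent.
   For the symmetric case let J be the diagonal matrix of the signs (-1)^i, with
   blocks numbered from 0.  Then D_n J = diag(S_i) is symmetric positive
   definite, while A_n J is the sum of diag(A_i) and a skew-symmetric matrix, so
   it has a positive quadratic form.  Pairing z A_n J = a z D_n J with the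
   conjugate of z and taking real parts yields Re a > 0. *)

Require Import Defs.
From mathcomp Require Import all_boot all_order all_algebra.
From mathcomp Require Import reals complex.
From mathcomp Require Import ring lra.

Import Order.TTheory GRing.Theory Num.Theory.
Local Open Scope ring_scope.

(** * Blocks and products of block bidiagonal matrices *)

Section TridiagBlock.
Variables (R : nzRingType) (m : nat -> nat).
Implicit Types (D : forall i, 'M[R]_(m i)) (U : forall i, 'M[R]_(m i, m i.+1))
  (L : forall i, 'M[R]_(m i.+1, m i)).

Lemma tridiag_block_diag D U L i : tridiag_block D U L i i = D i.
Proof. by rewrite /tridiag_block eqxx conform_mx_id. Qed.

Lemma tridiag_block_upper D U L i : tridiag_block D U L i i.+1 = U i.
Proof. by rewrite /tridiag_block ltn_eqF // eqxx conform_mx_id. Qed.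

Lemma tridiag_block_lower D U L i : tridiag_block D U L i.+1 i = L i.
Proof.
by rewrite /tridiag_block gtn_eqF // ltn_eqF ?eqxx ?conform_mx_id // ltnW.
Qed.

Lemma tridiag_block_eq0 D U L i j :
  i != j -> j != i.+1 -> i != j.+1 -> tridiag_block D U L i j = 0.
Proof. by rewrite /tridiag_block => /negPf-> /negPf-> /negPf->. Qed.

Lemma tridiag_block_gt D L i j :
  (i < j)%N -> tridiag_block D (fun=> 0) L i j = 0.
Proof.
move=> lt_ij; have [->|neq] := eqVneq j i.+1; first exact: tridiag_block_upper.
by rewrite tridiag_block_eq0 // ltn_eqF // ltnS ltnW.
Qed.

Lemma tridiag_block_lt D U i j :
  (j < i)%N -> tridiag_block D U (fun=> 0) i j = 0.
Proof.
move=> lt_ji; have [->|neq] := eqVneq i j.+1; first exact: tridiag_block_lower.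
by rewrite tridiag_block_eq0 // ?(gtn_eqF lt_ji) // ltn_eqF // ltnS ltnW.
Qed.

Lemma tridiag_mx_diagE n D :
  tridiag_mx n D (fun=> 0) (fun=> 0) = \mxdiag_(i < n) D i.
Proof.
apply: eq_mxblock => i j; have [->|neq] := eqVneq i j.
  by rewrite tridiag_block_diag conform_mx_id.
have := neq; rewrite -val_eqE neq_ltn => /orP[lt_ij|lt_ji].
  exact: tridiag_block_gt.
exact: tridiag_block_lt.
Qed.

(** A block row of the lower bidiagonal left factor has at most two nonzero blocks, so each block of
    the product is a sum of at most two terms. Both factorizations, [calL] times [calD] and [calP]
    times [calU], are instances. *)
Lemma mul_tridiag_mx n D L (D' D'' : forall i, 'M[R]_(m i))
    (U' U'' : forall i, 'M[R]_(m i, m i.+1))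
    (L'' : forall i, 'M[R]_(m i.+1, m i)) :
    (0 < n)%N -> D'' 0%N = D 0%N *m D' 0%N ->
    (forall i, (i.+1 < n)%N -> D'' i.+1 = D i.+1 *m D' i.+1 + L i *m U' i) ->
    (forall i, (i.+1 < n)%N -> U'' i = D i *m U' i) ->
    (forall i, (i.+1 < n)%N -> L'' i = L i *m D' i) ->
  tridiag_mx n D (fun=> 0) L *m tridiag_mx n D' U' (fun=> 0)
    = tridiag_mx n D'' U'' L''.
Proof.
move=> n_gt0 D0 DS US LS; rewrite mul_mxblock; apply: eq_mxblock => i k.
case: i => [[|i] lt_in] /=.
  rewrite (bigD1 (Ordinal lt_in)) //= big1 ?addr0 => [|j neq]; last first.
    rewrite tridiag_block_gt ?mul0mx //.
    by rewrite lt0n; apply: contraNneq neq => j0; apply/eqP/val_inj.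
  rewrite tridiag_block_diag; case: k => [[|[|k]] lt_kn] /=.
  - by rewrite !tridiag_block_diag.
  - by rewrite !tridiag_block_upper US.
  - by rewrite !tridiag_block_eq0 // mulmx0.
have lt_in' := ltnW lt_in.
rewrite (bigD1 (Ordinal lt_in)) //= (bigD1 (Ordinal lt_in')) /=; last first.
  by rewrite -val_eqE /= ltn_eqF.
rewrite big1 ?addr0 => [|j /andP[neqS neq]]; last first.
  have [lt_ij|le_ji] := ltnP i.+1 j; first by rewrite tridiag_block_gt ?mul0mx.
  rewrite tridiag_block_eq0 ?mul0mx //.
  - by apply: contraNneq neqS => eq_j; apply/eqP/val_inj.
  - by rewrite ltn_eqF // ltnS.
  - by rewrite eqSS; apply: contraNneq neq => eq_j; apply/eqP/val_inj.
rewrite tridiag_block_diag tridiag_block_lower.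
(* In block row i.+1 the subdiagonal, diagonal and superdiagonal positions are k = i, i.+1 and i.+2;
   for any other k both remaining terms vanish. *)
case: k => k lt_kn /=; have [lt_ki|lt_ik|eq_ki] := ltngtP k i.
- rewrite !tridiag_block_lt ?mulmx0 ?addr0 // ?leqW //.
  rewrite tridiag_block_eq0 // ?eqSS.
  - by rewrite gtn_eqF // leqW.
  - by rewrite ltn_eqF // !leqW // ltnW.
  - by rewrite gtn_eqF.
- have [eq_k|neqS] := eqVneq k i.+1.
    by rewrite eq_k !tridiag_block_diag tridiag_block_upper DS.
  have neq : i != k by rewrite ltn_eqF.
  have neqV : i != k.+1 by rewrite ltn_eqF // leqW.
  rewrite (tridiag_block_eq0 _ _ _ i) // mulmx0 addr0.
  have [eq_k|neqSS] := eqVneq k i.+2.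
    by rewrite eq_k !tridiag_block_upper US // -eq_k.
  by rewrite !tridiag_block_eq0 ?mulmx0 // eq_sym.
- by rewrite eq_ki !tridiag_block_lower tridiag_block_diag mulmx0 add0r LS.
Qed.

End TridiagBlock.

(** * Invertibility and nilpotency of block triangular matrices *)

Lemma tridiag_mx_unipotent_unit (R : fieldType) (m : nat -> nat) n
    (L : forall i, 'M[R]_(m i.+1, m i)) :
  tridiag_mx n (fun=> 1%:M) (fun=> 0) L \in unitmx.
Proof.
rewrite unitmxE det_trig.
  by rewrite big1 ?unitr1 // => s _; rewrite mxE tridiag_block_diag mxE eqxx.
apply/is_trig_mxblockP; split=> [i j|i]; first exact: tridiag_block_gt.
by rewrite tridiag_block_diag scalar_mx_is_trig.
Qed.

Lemma mxdiag_unit (R : fieldType) n (p : 'I_n -> nat)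
    (D : forall i, 'M[R]_(p i)) :
  (forall i, D i \in unitmx) -> \mxdiag_i D i \in unitmx.
Proof.
move=> D_unit.
suff /mulmx1_unit[] : \mxdiag_i D i *m \mxdiag_i invmx (D i) = 1%:M by [].
rewrite mul_mxblock_mxdiag -(mxdiagZ 1); apply: eq_mxblock => i j.
case: eqVneq => [->|_]; last by rewrite mul0mx.
by rewrite !conform_mx_id mulmxV.
Qed.

(** Each factor [N] raises the block index by at least one, so a chain of k factors starting at i
    ends at i + k or beyond. *)
Lemma submxblock_strict_upperX (R : nzRingType) n (p : 'I_n -> nat)
    (N : 'M[R]_(\sum_i p i)) :
    (forall i j : 'I_n, (j <= i)%N -> submxblock N i j = 0) ->
  forall (k : nat) (i j : 'I_n), (j < i + k)%N -> submxblock (N ^+ k) i j = 0.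
Proof.
move=> N_upper; elim=> [|k IHk] i j.
  rewrite addn0 expr0 -[1]/(1%:M) -(mxdiagZ 1) mxblockK => lt_ji.
  by rewrite -val_eqE /= gtn_eqF.
move=> lt_j; rewrite exprS -[_ * _]/(_ *m _).
rewrite -[N in N *m _]submxblockK -[N ^+ k]submxblockK mul_mxblock mxblockK.
(* In the term of index l, [N] vanishes if l <= i; if l > i, then j < i + k.+1 gives j < l + k and
   the induction hypothesis applies. *)
rewrite big1 // => l _; have [le_li|lt_il] := leqP l i.
  by rewrite N_upper ?mul0mx.
by rewrite IHk ?mulmx0 // (leq_trans lt_j) // addnS -addSn leq_add2r.
Qed.

Lemma strict_upper_mxblockX0 (R : nzRingType) n (p : 'I_n -> nat)
    (N : 'M[R]_(\sum_i p i)) :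
  (forall i j : 'I_n, (j <= i)%N -> submxblock N i j = 0) -> N ^+ n = 0.
Proof.
move=> N_upper; apply/mxblockP => i j; rewrite submxblock0.
by apply: submxblock_strict_upperX => //; apply: ltn_addl.
Qed.

(** * The factorizations of [calP] and [calA], and the nilpotency of [calU] minus the identity *)

Section BlockFactorization.
Variables (R : fieldType) (n : nat) (m : nat -> nat).
Variables (A : forall i, 'M[R]_(m i)) (B C : forall i, 'M[R]_(m i.+1, m i)).
Hypothesis n_gt0 : (0 < n)%N.
Hypothesis S_unit : forall i, (i < n)%N -> schur A B C i \in unitmx.

Lemma calP_LD : calP n A B C = calL n A B C *m calD n A B C.
Proof.
apply/esym/mul_tridiag_mx => // [|i _|i _|i lt_in].
- by rewrite mul1mx.
- by rewrite mul1mx mulmx0 addr0.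
- by rewrite mulmx0.
(* Subdiagonal blocks: the two signs (-1)^i multiply to one and the Schur complement cancels its
   inverse. *)
rewrite -scalemxAl -scalemxAr scalerA -exprD addnn -muln2 mulnC exprM sqrrN.
by rewrite !expr1n scale1r mulmxKV ?S_unit // ltnW.
Qed.

Lemma calA_PU : calA n A B C = calP n A B C *m calU n A B C.
Proof.
apply/esym/mul_tridiag_mx => // [|i lt_in|i lt_in|i _].
- by rewrite mulmx1.
(* The correction term inside [schur] carries the sign (-1)^(i+1) and the product term (-1)^i, so
   they cancel and leave the signed [A i.+1]. *)
- rewrite mulmx1 -scalemxAr mulmxA scalerDr exprS mulN1r !scaleNr.
  by rewrite subrK.
- rewrite -scalemxAl -scalemxAr scalerA -exprD addnn -muln2 mulnC exprM sqrrN.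
  by rewrite !expr1n scale1r mulKVmx ?S_unit // ltnW.
- by rewrite mulmx1.
Qed.

Lemma calD_unit : calD n A B C \in unitmx.
Proof.
rewrite /calD tridiag_mx_diagE; apply: mxdiag_unit => i.
rewrite unitmxE detZ unitrM -exprM unitrX ?unitrN1 //=.
by rewrite -unitmxE S_unit.
Qed.

Lemma calP_unit : calP n A B C \in unitmx.
Proof. by rewrite calP_LD unitmx_mul calD_unit tridiag_mx_unipotent_unit. Qed.

Lemma calU_sub1X0 : (calU n A B C - 1%:M) ^+ n = 0.
Proof.
apply: strict_upper_mxblockX0 => i j le_ji.
rewrite submxblockB -(mxdiagZ 1) !mxblockK.
move: le_ji; rewrite leq_eqVlt val_eqE => /predU1P[->|lt_ji].
  by rewrite tridiag_block_diag eqxx conform_mx_id subrr.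
by rewrite tridiag_block_lt // -val_eqE gtn_eqF // subr0.
Qed.

End BlockFactorization.

(** * Positive definite forms and eigenvalues of matrix pencils *)

Section PositiveDefinite.
Variable R : realType.

Lemma sympd_ge0 k (M : 'M[R]_k) (x : 'cV_k) :
  sympd M -> 0 <= (x^T *m M *m x) 0 0.
Proof.
move=> [_ M_gt0]; have [->|/M_gt0/ltW//] := eqVneq x 0.
by rewrite mulmx0 mxE.
Qed.

(** The form of [invmx M] at x is the form of [M] at y = M^-1 x. *)
Lemma sympd_invmx k (M : 'M[R]_k) :
  M \in unitmx -> sympd M -> sympd (invmx M).
Proof.
move=> M_unit [M_sym M_gt0]; split=> [|x x_neq0].
  by rewrite trmx_inv M_sym.
have y_neq0 : invmx M *m x != 0.
  by apply: contraNneq x_neq0 => y0; rewrite -(mulKVmx M_unit x) y0 mulmx0.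
have := M_gt0 _ y_neq0.
by rewrite trmx_mul trmx_inv M_sym mulmxKV // mulmxA.
Qed.

(** The congruence term is only semidefinite, since [C^T *m x] may vanish; strictness comes from
    [N]. *)
Lemma sympd_addcong k l (M : 'M[R]_k) (N : 'M[R]_l) (C : 'M[R]_(l, k)) :
  sympd N -> sympd M -> sympd (N + C *m M *m C^T).
Proof.
move=> [N_sym N_gt0] M_pd; split=> [|x x_neq0].
  by rewrite linearD /= !trmx_mul trmxK N_sym (proj1 M_pd) mulmxA.
rewrite mulmxDr mulmxDl mxE ltr_pwDl ?N_gt0 //.
have := sympd_ge0 _ _ (C^T *m x) M_pd.
by rewrite trmx_mul trmxK !mulmxA.
Qed.

Lemma sympd_mxdiag n (p : 'I_n -> nat) (D : forall i, 'M[R]_(p i)) :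
  (forall i, sympd (D i)) -> sympd (\mxdiag_i D i).
Proof.
move=> D_pd; split=> [|x x_neq0].
  by rewrite tr_mxdiag; apply: eq_mxdiag => i; case: (D_pd i).
rewrite -[x]submxcolK tr_mxcol mul_mxrow_mxdiag mul_mxrow_mxcol summxE.
have [i xi_neq0] : exists i, submxcol x i != 0.
  apply/existsP; apply: contraNT x_neq0; rewrite negb_exists => /forallP x0.
  apply/eqP/mxcolP => i; rewrite submxcol0; apply/eqP.
  by have := x0 i; rewrite negbK.
rewrite (bigD1 i) //= ltr_pwDl //; first by case: (D_pd i) => _; apply.
by apply: sumr_ge0 => j _; apply: sympd_ge0.
Qed.

(* Splitting [z = u + i v] and [a = Re a + i Im a], the real part of the pairing
   of the eigenvalue equation with the conjugate of [z] reads
   [u G u^T + v G v^T = Re a (u S u^T + v S v^T)]: the terms in [Im a] cancel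
   because [S] is symmetric. *)
Lemma pencil_eigenvalue_Re_gt0 k (G S : 'M[R]_k) (a : R[i])
    (z : 'rV[R[i]]_k) :
    (forall x : 'cV[R]_k, x != 0 -> 0 < (x^T *m G *m x) 0 0) -> sympd S ->
    z != 0 ->
    z *m map_mx (real_complex R) G = a *: (z *m map_mx (real_complex R) S) ->
  0 < complex.Re a.
Proof.
move=> G_gt0 S_pd z_neq0 eigen_z; have [S_sym S_gt0] := S_pd.
pose u := map_mx (@complex.Re R) z; pose v := map_mx (@complex.Im R) z.
have zE : z = map_mx (real_complex R) u + 'i%C *: map_mx (real_complex R) v.
  by apply/matrixP => i j; rewrite !mxE -complexE.
have [eq_re eq_im] :
  u *m G = complex.Re a *: (u *m S) - complex.Im a *: (v *m S) /\
  v *m G = complex.Im a *: (u *m S) + complex.Re a *: (v *m S).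
  move: eigen_z; rewrite zE !mulmxDl -!scalemxAl -!map_mxM.
  move: (u *m G) (v *m G) (u *m S) (v *m S) => p q r s /matrixP eq_pqrs.
  by split; apply/matrixP => i j; have := eq_pqrs i j; rewrite !mxE;
    case: a {eq_pqrs} => b c [eq_p eq_q] /=; lra.
have uv_neq0 : (u != 0) || (v != 0).
  apply: contraNT z_neq0; rewrite negb_or !negbK.
  move=> /andP[/eqP u0 /eqP v0].
  by rewrite zE u0 v0 !map_mx0 scaler0 addr0.
have cross : (u *m S *m v^T) 0 0 = (v *m S *m u^T) 0 0.
  by rewrite -[in LHS](trmxK u) -[in LHS]S_sym -!trmx_mul mxE mulmxA.
have eq_quad : (u *m G *m u^T) 0 0 + (v *m G *m v^T) 0 0 =
    complex.Re a * ((u *m S *m u^T) 0 0 + (v *m S *m v^T) 0 0).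
  rewrite eq_re eq_im mulmxBl mulmxDl -!scalemxAl !mxE.
  by move: cross; rewrite !mxE => ->; ring.
(* Needed for both [G] and [S]. One of [u] and [v] may vanish, hence one strict and one weak
   bound. *)
have quad_gt0 (M : 'M[R]_k) :
    (forall x : 'cV[R]_k, x != 0 -> 0 < (x^T *m M *m x) 0 0) ->
    0 < (u *m M *m u^T) 0 0 + (v *m M *m v^T) 0 0.
  move=> M_gt0; have M_ge0 (w : 'rV_k) : 0 <= (w *m M *m w^T) 0 0.
    have [->|] := eqVneq w 0; first by rewrite !mul0mx mxE.
    by rewrite -trmx_eq0 => /M_gt0/ltW; rewrite trmxK.
  have M_gt0' (w : 'rV_k) : w != 0 -> 0 < (w *m M *m w^T) 0 0.
    by rewrite -trmx_eq0 => /M_gt0; rewrite trmxK.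
  by case/orP: uv_neq0 => /M_gt0' w_gt0; [apply: ltr_pwDl | apply: ltr_wpDl].
by rewrite -(pmulr_lgt0 _ (quad_gt0 S S_gt0)) -eq_quad quad_gt0.
Qed.

End PositiveDefinite.

(** * Definiteness in the symmetric case, and the theorem *)

Section Symmetric.
Variables (R : realType) (n : nat) (m : nat -> nat).
Variables (A : forall i, 'M[R]_(m i)) (B C : forall i, 'M[R]_(m i.+1, m i)).
Hypothesis A_sym : (calA n A B C)^T = calA n A B C.
Hypothesis A_pd : forall i, (i < n)%N -> sympd (A i).

Lemma calA_block_sym (i j : 'I_n) :
  (tridiag_block (fun i => (-1) ^+ i *: A i) (fun i => (B i)^T) C j i)^T =
  tridiag_block (fun i => (-1) ^+ i *: A i) (fun i => (B i)^T) C i j.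
Proof.
by move: A_sym; rewrite /calA /tridiag_mx tr_mxblock => /eq_mxblockP/(_ i j).
Qed.

(** Symmetry of [calA] forces C i = B i, so each step of the Schur recursion adds to a positive
    definite block a congruence of the inverse of the previous complement. *)
Lemma schur_sympd i :
    (forall k, (k < n)%N -> schur A B C k \in unitmx) -> (i < n)%N ->
  sympd (schur A B C i).
Proof.
move=> S_unit; elim: i => [|i IHi] lt_in; first exact: A_pd.
have lt_in' := ltnW lt_in.
have lower_eq : C i = B i.
  have := calA_block_sym (Ordinal lt_in) (Ordinal lt_in').
  by rewrite /= tridiag_block_upper tridiag_block_lower => <-; rewrite trmxK.
rewrite /= lower_eq; apply: sympd_addcong; first exact: A_pd.
by apply: sympd_invmx; [apply: S_unit | apply: IHi].
Qed.

(* Flipping the signs of every other block column makes the off-diagonal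
   part of [calA] skew-symmetric, so that it disappears from the quadratic form,
   and leaves the blocks [A i] on the diagonal. *)
Lemma calA_sign_gt0 (x : 'cV[R]_(\sum_(i < n) m i)) : x != 0 ->
  0 < (x^T *m (calA n A B C *m \mxdiag_(i < n) ((-1) ^+ i)%:M) *m x) 0 0.
Proof.
set G := calA n A B C *m _.
have GE : G + G^T = \mxdiag_(i < n) A i + \mxdiag_(i < n) A i.
  rewrite /G mul_mxblock_mxdiag tr_mxblock -!mxblockD; apply: eq_mxblock => i j.
  (* Block (i, j) of G + G^T is the block of [calA] times (-1)^j + (-1)^i, a factor that is zero for
     adjacent i and j. *)
  rewrite !mul_mx_scalar linearZ /= calA_block_sym -scalerDl.
  case: eqVneq => [->|neq].
    rewrite tridiag_block_diag conform_mx_id scalerA mulrDl -exprD addnn -muln2.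
    by rewrite mulnC exprM sqrrN !expr1n scalerDl scale1r.
  have [eqj|neqj] := eqVneq (j : nat) i.+1.
    by rewrite eqj exprS mulN1r addNr scale0r addr0.
  have [eqi|neqi] := eqVneq (i : nat) j.+1.
    by rewrite eqi exprS mulN1r addrN scale0r addr0.
  by rewrite tridiag_block_eq0 ?scaler0 ?addr0.
have [_ A_gt0] : sympd (\mxdiag_(i < n) A i).
  by apply: sympd_mxdiag => i; apply: A_pd.
move=> /A_gt0; have tr_quad : (x^T *m G^T *m x) 0 0 = (x^T *m G *m x) 0 0.
  by rewrite -mulmxA -[in LHS](trmxK x) -!trmx_mul mxE trmxK mulmxA.
move/(congr1 (fun M => (x^T *m M *m x) 0 0)): GE.
rewrite !(mulmxDl, mulmxDr) [LHS]mxE [RHS]mxE tr_quad.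
lra.
Qed.

End Symmetric.

Theorem theorem3p1 (R : realType) (n : nat) (m : nat -> nat)
    (A : forall i : nat, 'M[R]_(m i))
    (B C : forall i : nat, 'M[R]_(m i.+1, m i))
    (hn : (2 <= n)%N)
    (hm : forall i : nat, (i < n)%N -> (1 <= m i)%N)
    (hS : forall i : nat, (i < n)%N -> schur A B C i \in unitmx) :
  [/\ calP n A B C = calL n A B C *m calD n A B C,
      calP n A B C \in unitmx,
      invmx (calP n A B C) *m calA n A B C = calU n A B C &
      (invmx (calP n A B C) *m calA n A B C - 1%:M) ^+ n = 0]
  /\
  ((calA n A B C)^T = calA n A B C ->
   (forall i : nat, (i < n)%N -> sympd (A i)) ->
   calD n A B C \in unitmx /\
   positive_real_eigenvalues (invmx (calD n A B C) *m calA n A B C)).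
Proof.
have n_gt0 : (0 < n)%N by apply: leq_trans hn.
have P_unit := calP_unit _ _ _ A B C n_gt0 hS.
have D_unit := calD_unit _ _ _ A B C hS.
have PA_U : invmx (calP n A B C) *m calA n A B C = calU n A B C.
  by rewrite (calA_PU _ _ _ A B C n_gt0 hS) mulKmx.
split; first by split; rewrite ?PA_U ?calU_sub1X0 //; apply: calP_LD.
move=> A_sym A_pd; split=> // a /eigenvalueP[w eigen_w w_neq0].
pose J : 'M[R]_(\sum_(i < n) m i) := \mxdiag_(i < n) ((-1) ^+ i)%:M.
have DJ : calD n A B C *m J = \mxdiag_(i < n) schur A B C i.
  rewrite /calD tridiag_mx_diagE mul_mxblock_mxdiag; apply: eq_mxblock => i j.
  case: eqVneq => [->|_]; last by rewrite mul0mx.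
  rewrite !conform_mx_id -scalemxAl mul_mx_scalar scalerA -exprD addnn -muln2.
  by rewrite mulnC exprM sqrrN !expr1n scale1r.
have S_pd : sympd (\mxdiag_(i < n) schur A B C i).
  by apply: sympd_mxdiag => i; apply: schur_sympd A_sym A_pd _ hS (ltn_ord i).
have AJ_gt0 := calA_sign_gt0 _ _ _ _ _ _ A_sym A_pd.
(* Eigenvectors here are row vectors, so w D^-1 A = a w. With z = w D^-1 this reads z A = a z D, and
   multiplying by J on the right gives the pencil with a definite right-hand side. *)
pose z := w *m map_mx (real_complex R) (invmx (calD n A B C)).
have wE : w = z *m map_mx (real_complex R) (calD n A B C).
  by rewrite /z map_invmx mulmxKV // map_unitmx.
apply: (pencil_eigenvalue_Re_gt0 _ _ _ _ a z AJ_gt0 S_pd).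
  by apply: contraNneq w_neq0 => z0; rewrite wE z0 mul0mx.
rewrite -DJ !map_mxM !mulmxA -wE scalemxAl -eigen_w /z.
by rewrite map_mxM mulmxA.
Qed.
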